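(* Let $k, n$ be integers with $2 < k < n$. Then for every convex sequence $\mathbf{M} = (M_s)_{0 \le s \le \ell}$ of matrices in $\mathcal{C}^\ast \subset \mathbb{R}^{k \times n}$ we have \[ \operatorname{nsc}(\mathbf{M}) < \frac{(n-k+1)^{2k-3}}{2^{k-3}}. \]
   Context: Let $0<k<n$ be integers and $\mathcal{C} = \mathbb{R}^{k\times n}$ the space of real $k \times n$ matrices; $Me_j$ denotes the $j$-th column of $M$. Positive elementary move: for $M_0, M_1 \in \mathcal{C}$, there exists a positive elementary move from $M_0$ to $M_1$ if there exist $j \in \{1,\dots,n-1\}$ and $t \in (0,+\infty)$ such that $M_1 e_j = M_0 e_j + t M_0 e_{j+1}$ and $M_1 e_{j'} = M_0 e_{j'}$ for all $j' \ne j$. Convex sequence: a finite sequence $(M_s)_{0\le s\le \ell}$ of $k \times n$ matrices is convex if for every integer $s$ with $0 \le s < \ell$ there exists a positive elementary move from $M_s$ to $M_{s+1}$. For $J = \{j_1 < \cdots < j_k\} \subset \{1,\ldots,n\}$, let $m_J(M) = \det(Me_{j_1}, \ldots, Me_{j_k})$, and let $m_\bullet = m_{\{1,\ldots,k\}}$. Let $\mathcal{C}^\ast \subset \mathcal{C}$ be the set of matrices $M$ with $m_J(M) \neq 0$ for all $J \subset \{1,\dots,n\}$ with $|J| = k$. Number of sign changes: for a convex sequence $\mathbf{M} = (M_s)_{0\le s\le\ell}$ of matrices in $\mathcal{C}^\ast$, \[ \operatorname{nsc}(\mathbf{M}) = |\{ s \in \mathbb{Z} : 0 \le s < \ell,\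 m_\bullet(M_s)\, m_\bullet(M_{s+1}) < 0 \}|. \] *)

(* Defs.v *)
From HB Require Import structures.
From mathcomp Require Import all_boot all_order all_algebra.
From mathcomp Require Import reals.
Set Implicit Arguments.
Unset Strict Implicit.
Unset Printing Implicit Defensive.
Import Order.TTheory GRing.Theory Num.Theory.
Local Open Scope ring_scope.

(* Columns are indexed from 0: M e_(j+1) is [col j M]. *)

Definition positive_move (R : realType) (k n : nat) (M0 M1 : 'M[R]_(k, n)) : Prop :=
  exists (j j1 : 'I_n) (t : R),
    [/\ nat_of_ord j1 = j.+1,
        0 < t,
        col j M1 = col j M0 + t *: col j1 M0
      & forall j' : 'I_n, j' != j -> col j' M1 = col j' M0].

(* A sequence (M_s), 0 <= s <= l, is a function on 'I_l.+1. For s : 'I_l,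
   [seq_cur M s] is M_s and [seq_next M s] is M_(s+1). *)
Definition seq_cur (T : Type) (l : nat) (M : 'I_l.+1 -> T) (s : 'I_l) : T :=
  M (widen_ord (leqnSn l) s).

Definition seq_next (T : Type) (l : nat) (M : 'I_l.+1 -> T) (s : 'I_l) : T :=
  M (lift ord0 s).

Definition convex_seq (R : realType) (k n l : nat)
    (M : 'I_l.+1 -> 'M[R]_(k, n)) : Prop :=
  forall s : 'I_l, positive_move (seq_cur M s) (seq_next M s).

(* [enum_val] lists the elements of J in increasing order (see
   [subset_elt_increasing]), so this is j_(i+1) for J = {j_1 < ... < j_k}. *)
Definition subset_elt (k n : nat) (J : {set 'I_n}) (HJ : #|J| = k) (i : 'I_k) :
    'I_n :=
  enum_val (cast_ord (esym HJ) i).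

Lemma subset_elt_increasing (k n : nat) (J : {set 'I_n}) (HJ : #|J| = k)
    (i i' : 'I_k) :
  (i < i')%N -> (subset_elt HJ i < subset_elt HJ i')%N.
Proof.
move=> lt_ii'; have sJ : sorted ltn (map val (enum J)).
  rewrite {1}/enum_mem -enumT; apply: (subseq_sorted ltn_trans (s2 := iota 0 n)).
    by rewrite -val_enum_ord; apply: map_subseq; apply: filter_subseq.
  exact: iota_ltn_sorted.
have lt_size (h : 'I_k) : (h < size (enum J))%N by rewrite -cardE HJ.
have E (h : 'I_k) : subset_elt HJ h = nth 0%N (map val (enum J)) h :> nat.
  by rewrite /subset_elt /enum_val (nth_map (enum_default (cast_ord (esym HJ) h))).
rewrite !E; apply: (sorted_ltn_nth ltn_trans) => //; by rewrite inE size_map.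
Qed.

Definition minorJ (R : realType) (k n : nat) (J : {set 'I_n}) (HJ : #|J| = k)
    (M : 'M[R]_(k, n)) : R :=
  \det (colsub (subset_elt HJ) M).

Definition first_cols (k n : nat) : {set 'I_n} := [set j : 'I_n | (j < k)%N].

Lemma card_first_cols (k n : nat) : (k <= n)%N -> #|first_cols k n| = k.
Proof.
move=> le_kn; rewrite -[RHS]card_ord -(card_imset predT (f := widen_ord le_kn)).
  apply: eq_card => j; rewrite inE; apply/idP/imsetP => [lt_jk | [i _ ->] //=].
  by exists (Ordinal lt_jk) => //; apply: val_inj.
by move=> i i' /(congr1 val) /= /val_inj.
Qed.

Definition m_bullet (R : realType) (k n : nat) (le_kn : (k <= n)%N)
    (M : 'M[R]_(k, n)) : R :=
  minorJ (card_first_cols le_kn) M.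

Definition in_Cstar (R : realType) (k n : nat) (M : 'M[R]_(k, n)) : Prop :=
  forall (J : {set 'I_n}) (HJ : #|J| = k), minorJ HJ M != 0.

Definition nsc (R : realType) (k n : nat) (le_kn : (k <= n)%N) (l : nat)
    (M : 'I_l.+1 -> 'M[R]_(k, n)) : nat :=
  #|[set s : 'I_l |
      m_bullet le_kn (seq_cur M s) * m_bullet le_kn (seq_next M s) < 0]|.

(* Main.v *)
Require Import Defs.
From HB Require Import structures.
From mathcomp Require Import all_boot all_order all_algebra.
From mathcomp Require Import all_fingroup.
From mathcomp Require Import reals.
From mathcomp Require Import zify ring lra.
Set Implicit Arguments.
Unset Strict Implicit.
Unset Printing Implicit Defensive.
Import Order.TTheory GRing.Theory Num.Theory.
Local Open Scope ring_scope.

(** Call an interval minor of [M] the minor [F(p,a)] on the [p] consecutive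
    columns [a, ..., a+p-1] together with the last [k-p] columns; [m_bullet] is
    [F(k,0)] up to a constant sign.  Put [e = n-k] and [d = e-a].  The move
    [v_j += t v_(j+1)] changes a minor only if its column set contains [j] but
    not [j+1], so it changes [F(p,a)] only when [p > 0], [d > 0] and
    [j = a+p-1], the last column of the interval.

    Let [F(p+1,a)] change sign at such a move, and let
    [P, P'] be its values before and after, so that [P' = P + t Q] with [Q] the
    minor obtained by replacing column [a+p] by column [a+p+1].  Then [Q] has
    the sign of [P'].  For [p > 0], the three-term Plücker relation
    for the columns [a], [a+p], [a+p+1] and the first of the last [k-p] columns
    reads, up to a common sign,
      [Q F(p,a+1) = P r + F(p,a) F(p+1,a+1)]
    for some minor [r], and it holds with [P'] and the new value of
    [F(p,a+1)] as well.  As [P] and [P'] have opposite signs, the term [P r] or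
    [P' r] cannot spoil the sign both before and after the move; so, unless the
    product [g = F(p+1,a+1) F(p,a) F(p,a+1)] changes sign in the same move, the
    new value of [F(p+1,a)] has the sign of [g] ([sign_change_event]).  For
    [p = 0] this is clear: then [F(p,a) = F(p,a+1)] and [Q = F(p+1,a+1)].
    Successive sign changes of [F(p+1,a)] lead to alternating signs, hence [g]
    changes sign between any two of them ([sign_changes_comparison]) and
      [#F(p+1,a) <= 1 + #F(p+1,a+1) + #F(p,a) + #F(p,a+1)]
    where [#] counts sign changes along the sequence.

    All three minors on the right are again interval minors of the same
    matrices, with a smaller [p] or a smaller [d], so the number of sign changes
    is at most the solution [B(p,d)] of
      [B(p+1,d+1) = 1 + B(p+1,d) + B(p,d+1) + B(p,d)]
    vanishing for [p = 0] and for [d = 0] ([block_minor_sign_changes]); note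
    that [2 B + 1] satisfies the recurrence of the Delannoy numbers.  Finally
    [3 B(3,d) = 2d^3+3d^2+4d < 3(d+1)^3] and [2 B(p+1,d) <= (d+1)^2 B(p,d)] for
    [p > 0], whence the bound, by induction on [k]. *)

(** * Sign changes of sequences of reals *)

Definition sign_changes (R : realType) (f : nat -> R) (l : nat) : nat :=
  \sum_(s < l) (f s * f s.+1 < 0)%R.

Lemma sign_changesS (R : realType) (f : nat -> R) (l : nat) :
  sign_changes f l.+1 = (sign_changes f l + (f l * f l.+1 < 0)%R)%N.
Proof. by rewrite /sign_changes big_ord_recr. Qed.

Lemma sign_changesM (R : realType) (f g : nat -> R) (l : nat) :
  (sign_changes (fun s => f s * g s)%R l <= sign_changes f l + sign_changes g l)%N.
Proof.
rewrite /sign_changes -big_split /=; apply: leq_sum => s _.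
rewrite mulrACA; case: ltrP => //= fg0.
case: (ltrP (f s * _)) => // f0; case: ltrP => // g0.
by move: fg0; rewrite ltNge mulr_ge0.
Qed.

(** If every sign change of [f] moves to the current sign of [g], or happens
    together with a sign change of [g], then [g] must change sign between
    two consecutive sign changes of [f]; the extra [1] accounts for the first
    one. *)
Lemma sign_changes_comparison (R : realType) (f g : nat -> R) (l : nat) :
    (forall s, (s <= l)%N -> f s != 0) -> (forall s, (s <= l)%N -> g s != 0) ->
    (forall s, (s < l)%N -> f s * f s.+1 < 0 -> 0 < g s * g s.+1 ->
       0 < f s.+1 * g s.+1) ->
  (sign_changes f l <= (sign_changes g l).+1)%N.
Proof.
move=> f0 g0 fg.
(* If [f] and [g] disagree at the end, the extra [1] has not been spent yet;
   this refinement is what makes the induction work. *)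
suff [] : (sign_changes f l <= (sign_changes g l).+1)%N /\
    (f l * g l < 0 -> (sign_changes f l <= sign_changes g l)%N) by [].
elim: l f0 g0 fg => [|l IH] f0 g0 fg.
  by rewrite /sign_changes !big_ord0.
have [|||IH1 IH2] := IH.
- by move=> s sl; apply: f0; apply: leqW.
- by move=> s sl; apply: g0; apply: leqW.
- by move=> s sl; apply: fg; apply: leqW.
have := f0 l (leqnSn l); have := f0 _ (leqnn l.+1).
have := g0 l (leqnSn l); have := g0 _ (leqnn l.+1).
have := fg l (leqnn _); rewrite !sign_changesS.
move: IH1 IH2; move: (sign_changes f l) (sign_changes g l) => m q.
move: (f l) (f l.+1) (g l) (g l.+1) => x x' y y' {f0 g0 fg IH}.
case: (ltrgt0P x) => // hx; case: (ltrgt0P x') => // hx';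
case: (ltrgt0P y) => // hy; case: (ltrgt0P y') => // hy'.
all: rewrite ?(pmulr_llt0 _ hx') ?(nmulr_llt0 _ hx') ?(pmulr_llt0 _ hy')
  ?(nmulr_llt0 _ hy') ?(pmulr_llt0 _ hy) ?(nmulr_llt0 _ hy)
  ?(pmulr_lgt0 _ hy') ?(nmulr_lgt0 _ hy') ?(lt_gtF hx) ?(lt_gtF hx')
  ?(lt_gtF hy) ?(lt_gtF hy') ?hx ?hx' ?hy ?hy' => m1 m2 H _ _ _ _.
all: split=> [|//]; try (move=> _); try lia.
all: try (by have := m2 isT; lia).
all: try (by have := H isT isT).
Qed.

(** * Determinants as functions of two rows *)

Section RowDeterminants.
Variables (R : realType) (k : nat).
Implicit Types (f : 'I_k -> 'rV[R]_k) (x y u w z : 'rV[R]_k).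

Definition rdet f : R := \det (\matrix_(i < k) f i).

Definition repl f (i0 : 'I_k) x : 'I_k -> 'rV[R]_k :=
  fun i => if i == i0 then x else f i.

Lemma rdet_ext f f' : f =1 f' -> rdet f = rdet f'.
Proof. by move=> E; congr (\det _); apply/row_matrixP => i; rewrite !rowK. Qed.

Lemma rdet_alternate f i j : i != j -> f i = f j -> rdet f = 0.
Proof.
move=> ij E; apply: (determinant_alternate ij) => c.
by rewrite !mxE E.
Qed.

Lemma rdet_perm f (s : 'S_k) : rdet (f \o s) = (-1) ^+ s * rdet f.
Proof.
rewrite -det_perm -det_mulmx -row_permE; congr (\det _).
by apply/matrixP => i j; rewrite !mxE.
Qed.

Lemma rdet_linear f i : exists c : 'cV[R]_k, forall x, rdet (repl f i x) = (x *m c) 0 0.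
Proof.
exists (\col_j cofactor (\matrix_a repl f i 0 a) i j) => x.
rewrite /rdet (expand_det_row _ i) mxE; apply: eq_bigr => j _.
rewrite !mxE /repl eqxx; congr (_ * (_ * \det _)).
by apply/matrixP => a b; rewrite !mxE eq_sym (negPf (neq_lift _ _)).
Qed.

Lemma rdet_move f i x y t :
  rdet (repl f i (x + t *: y)) = rdet (repl f i x) + t * rdet (repl f i y).
Proof.
have [c E] := rdet_linear f i.
by rewrite !E mulmxDl -scalemxAl !mxE.
Qed.

Definition rdet2 f i j x y := rdet (repl (repl f j y) i x).

Lemma rdet2C f i j x y : i != j -> rdet2 f i j x y = - rdet2 f i j y x.
Proof.
move=> ij; have := rdet_perm (repl (repl f j x) i y) (tperm i j).
rewrite odd_tperm ij expr1 mulN1r => <-; apply: rdet_ext => a.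
rewrite /= /repl; case: tpermP => [->|->|/eqP/negPf-> /eqP/negPf->//].
  by rewrite !eqxx eq_sym (negPf ij).
by rewrite !eqxx eq_sym (negPf ij).
Qed.

(** The left-hand side is linear in [x].  By the antisymmetry of [rdet2] it
    vanishes for [x = y] and [x = z], and also when [x] is one of the
    remaining rows [f a]; when [rdet2 f i j y z] is nonzero these vectors
    form a basis. *)
Lemma plucker_basis f i j x y u z : i != j -> rdet2 f i j y z != 0 ->
  rdet2 f i j x y * rdet2 f i j u z - rdet2 f i j x u * rdet2 f i j y z
    + rdet2 f i j x z * rdet2 f i j y u = 0.
Proof.
move=> ij nz.
have [cy Ey] := rdet_linear (repl f j y) i.
have [cu Eu] := rdet_linear (repl f j u) i.
have [cz Ez] := rdet_linear (repl f j z) i.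
(* The linear form of [x] on the left-hand side, as a column vector. *)
pose e := rdet2 f i j u z *: cy - rdet2 f i j y z *: cu + rdet2 f i j y u *: cz.
have E v : (v *m e) 0 0 = rdet2 f i j v y * rdet2 f i j u z
  - rdet2 f i j v u * rdet2 f i j y z + rdet2 f i j v z * rdet2 f i j y u.
  rewrite {1 3 5}/rdet2 Ey Eu Ez /e !(mulmxDr, mulmxBr) mulmxN -!scalemxAr.
  by rewrite !mxE; ring.
rewrite -E.
pose N := \matrix_a (repl (repl f j z) i y) a.
have Ne : N *m e = 0.
  apply/row_matrixP => a; rewrite row_mul row0 rowK.
  apply/rowP => b; rewrite ord1 E mxE /repl; case: eqP => [_|/eqP ai].
    rewrite [rdet2 f i j y y]rdet2C //.
    have -> : rdet2 f i j y y = 0.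
      have := rdet2C f y y ij; move: (rdet2 _ _ _ _ _) => r.
      by lra.
    ring.
  case: eqP => [_|/eqP aj].
    have -> : rdet2 f i j z z = 0.
      have := rdet2C f z z ij; move: (rdet2 _ _ _ _ _) => r.
      by lra.
    by rewrite (rdet2C f z y) // (rdet2C f z u) //; ring.
  have Z v : rdet2 f i j (f a) v = 0.
    apply: (rdet_alternate ai).
    by rewrite /repl eqxx (negPf ai) (negPf aj).
  by rewrite !Z; ring.
have -> : e = 0.
  have NU : N \in unitmx by rewrite unitmxE unitfE.
  by rewrite -(mulKmx NU e) Ne mulmx0.
by rewrite mulmx0 mxE.
Qed.

(** The relation is symmetric, up to sign, in [y], [u], [z], and each of its terms
    contains a factor involving two of them: either one of these factors
    is nonzero and [plucker_basis] applies, or all terms vanish. *)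
Lemma plucker f i j x y u z : i != j ->
  rdet2 f i j x y * rdet2 f i j u z - rdet2 f i j x u * rdet2 f i j y z
    + rdet2 f i j x z * rdet2 f i j y u = 0.
Proof.
move=> ij.
have [yz|] := eqVneq (rdet2 f i j y z) 0; last exact: plucker_basis.
have [uz|nz] := eqVneq (rdet2 f i j u z) 0; last first.
  have := plucker_basis x y ij nz.
  rewrite (rdet2C f u y) //; lra.
have [yu|nz] := eqVneq (rdet2 f i j y u) 0; last first.
  have := plucker_basis x z ij nz.
  rewrite (rdet2C f z u) // (rdet2C f y z) //; lra.
by rewrite yz uz yu !mulr0; ring.
Qed.

End RowDeterminants.

(** * The numerical recurrence *)

(** [(D - 1) / 2] for the Delannoy number [D] at [(p, d)]. *)
Fixpoint half_delannoy (p d : nat) : nat :=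
  if p is p'.+1 then
    \sum_(i < d) (1 + half_delannoy p' i.+1 + half_delannoy p' i)%N
  else 0.

Lemma half_delannoy0 p : half_delannoy p 0 = 0%N.
Proof. by case: p => //= p; rewrite big_ord0. Qed.

Lemma half_delannoyS p d : half_delannoy p.+1 d.+1 =
  (half_delannoy p.+1 d + (1 + half_delannoy p d.+1 + half_delannoy p d))%N.
Proof. by rewrite /= big_ord_recr. Qed.

Lemma half_delannoy_lt p d : (half_delannoy p.+1 d < half_delannoy p.+1 d.+1)%N.
Proof. by rewrite half_delannoyS; lia. Qed.

Lemma half_delannoy1 d : half_delannoy 1 d = d.
Proof. by elim: d => [|d IH]; rewrite ?half_delannoy0 // half_delannoyS IH /=; lia. Qed.

Lemma half_delannoy2 d : half_delannoy 2 d = (d * d.+1)%N.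
Proof.
elim: d => [|d IH]; rewrite ?half_delannoy0 // half_delannoyS IH !half_delannoy1; nia.
Qed.

Lemma half_delannoy3 d :
  (3 * half_delannoy 3 d = 2 * d ^ 3 + 3 * d ^ 2 + 4 * d)%N.
Proof.
elim: d => [|d IH]; rewrite ?half_delannoy0 //.
rewrite half_delannoyS !mulnDr IH !half_delannoy2 !expnS expn0; nia.
Qed.

(** For [d > 1] the recurrence and the induction hypothesis at [d - 1] give
    [2 B(p+2,d) <= (d^2 + 4) B(p+1,d) - d^2], using that [B(p+1,.)] increases,
    and [d^2 + 4 <= (d + 1)^2].  For [d = 1] the induction hypothesis
    is empty, but the terms at [d - 1 = 0] vanish. *)
Lemma half_delannoy_step p d :
  (2 * half_delannoy p.+2 d <= d.+1 ^ 2 * half_delannoy p.+1 d)%N.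
Proof.
elim: d => [|d IH]; first by rewrite !half_delannoy0.
have lt := half_delannoy_lt p d; rewrite half_delannoyS !mulnDr.
case: d IH lt => [|d] IH lt.
  by move: IH lt; rewrite !half_delannoy0; lia.
move: IH lt; move: (half_delannoy p.+2 _) (half_delannoy p.+1 _) => a b.
move: (half_delannoy p.+1 _) => c.
rewrite !expnS !expn0 => IH lt; nia.
Qed.

Lemma half_delannoy_bound k d : (0 < d)%N ->
  (2 ^ k * half_delannoy k.+3 d < d.+1 ^ (2 * k).+3)%N.
Proof.
move=> d0; elim: k => [|k IH].
  have := half_delannoy3 d; rewrite mul1n muln0 !expnS expn0; nia.
have := half_delannoy_step k.+2 d.
have -> : ((2 * k.+1).+3 = 2 + (2 * k).+3)%N by lia.
rewrite expnD (expnS 2 k) => st.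
have q0 : (0 < d.+1 ^ 2)%N by rewrite expn_gt0.
have : (2 ^ k * (2 * half_delannoy k.+4 d)
         <= 2 ^ k * (d.+1 ^ 2 * half_delannoy k.+3 d))%N.
  by rewrite leq_mul2l st orbT.
have : (d.+1 ^ 2 * (2 ^ k * half_delannoy k.+3 d)
         < d.+1 ^ 2 * d.+1 ^ (2 * k).+3)%N.
  by rewrite ltn_pmul2l.
move: (2 ^ k)%N (d.+1 ^ 2)%N (d.+1 ^ _)%N => a q b lt le.
move: (half_delannoy _ _) (half_delannoy _ _) lt le => u v; lia.
Qed.

(** * Interval minors under elementary moves *)

Ltac split_ifs := repeat (case: ifP => ?).

Section BlockMinors.
Variables (R : realType) (k : nat).
Implicit Types (V W : nat -> 'rV[R]_k) (p a e j : nat) (t : R).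

(** Index, in increasing order, of the [i]-th column of the set made of
    [a, ..., a+p-1] and of the last [k-p] columns, when there are [e+k] columns. *)
Definition block_index p a e (i : nat) : nat := (if i < p then a + i else e + i)%N.

Definition block_minor V p a e : R := rdet (fun i : 'I_k => V (block_index p a e i)).

Definition vector_move V W j t : Prop :=
  W j = V j + t *: V j.+1 /\ forall i, i <> j -> W i = V i.

(** When [j] is a chosen column, so is [j+1], and adding a multiple of one column
    to another does not change a determinant.  For [a = e] the two blocks
    touch, so that the end of the first one is no exception. *)
Lemma block_minor_unchanged V W j t p a e :
    vector_move V W j t -> (j.+1 < e + k)%N -> (a <= e)%N -> (p <= k)%N ->
    [\/ p = 0%N, a = e | j.+1 <> (a + p)%N] ->
  block_minor W p a e = block_minor V p a e.
Proof.
move=> [Wj Wi] jn ae pk hyp; rewrite /block_minor.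
case: (pickP (fun i : 'I_k => block_index p a e i == j)) => [i /eqP hi|none].
  have [i' hi'] : exists i' : 'I_k, block_index p a e i' = j.+1.
    have ik : (i.+1 < k)%N.
      have := ltn_ord i; move: hi hyp; rewrite /block_index.
      by case: ifP => ? ? [] ?; lia.
    exists (Ordinal ik); move: hi hyp; rewrite /block_index /=.
    by case: ifP; case: ifP => ? ? ? [] ?; lia.
  have ii' : i != i' by apply: contra_eq_neq hi => ->; rewrite hi'; lia.
  pose f (x : 'I_k) := V (block_index p a e x).
  rewrite (_ : rdet _ = rdet (repl f i (V j + t *: V j.+1))); last first.
    apply: rdet_ext => x; rewrite /repl; case: eqP => [->|xi]; first by rewrite hi.
    rewrite Wi // => hx; apply: xi; apply: val_inj; move: hx; rewrite -hi /block_index.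
    by have := ltn_ord i; have := ltn_ord x; case: ifP; case: ifP => /=; lia.
  rewrite rdet_move (rdet_alternate (f := repl f i (V j.+1)) ii'); last first.
    by rewrite /repl eqxx eq_sym (negPf ii') /f hi'.
  rewrite mulr0 addr0; apply: rdet_ext => x; rewrite /repl.
  by case: eqP => [->|//]; rewrite hi.
by apply: rdet_ext => i; apply: Wi; apply/eqP; rewrite none.
Qed.

(** The rows of [T] away from the two positions that the Plücker relation varies. *)
Definition agrees_off (T : 'I_k -> 'rV[R]_k) V p a e (i0 ip : 'I_k) : Prop :=
  forall i, i != i0 -> i != ip -> T i = V (block_index p a e i).

Lemma block_minor_first T V p a e (i0 ip : 'I_k) :
    i0 = 0%N :> nat -> ip = p :> nat -> (0 < p)%N -> agrees_off T V p a e i0 ip ->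
  block_minor V p.+1 a e = rdet2 T i0 ip (V a) (V (a + p)%N) /\
  block_minor V p a e = rdet2 T i0 ip (V a) (V (e + p)%N).
Proof.
move=> h0 hp p0 TV; split; apply: rdet_ext => i; rewrite /repl.
all: case: eqP => [->|/eqP n0]; first by rewrite /block_index h0 ?p0 ?addn0.
all: case: eqP => [->|/eqP np]; first by rewrite /block_index hp ?ltnSn ?ltnn.
  rewrite TV //; congr V; rewrite /block_index.
  by move: np; rewrite -val_eqE /= hp; case: ifP; case: ifP; lia.
by rewrite TV.
Qed.

(** A block starting at [a+1] lists the common rows from position [0] instead of
    position [1]; the cyclic permutation [s] of the positions [0, ..., p-1] brings
    them back to the places where [T] has them, at the cost of a sign depending
    on [p] only. *)
Lemma block_minor_shift p (i0 ip : 'I_k) :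
    i0 = 0%N :> nat -> ip = p :> nat -> (0 < p)%N ->
  exists b : bool, forall T V a e, agrees_off T V p a e i0 ip ->
  block_minor V p a.+1 e = (-1) ^+ b * rdet2 T i0 ip (V (a + p)%N) (V (e + p)%N) /\
  block_minor V p.+1 a.+1 e
    = (-1) ^+ b * rdet2 T i0 ip (V (a + p)%N) (V (a + p).+1).
Proof.
move=> h0 hp p0; have pk : (p < k)%N by rewrite -hp.
pose s (i : nat) := (if i < p.-1 then i.+1 else if i == p.-1 then 0 else i)%N.
have sk (i : 'I_k) : (s i < k)%N.
  by have := ltn_ord i; rewrite /s; split_ifs; lia.
have s_inj : injective (fun i => Ordinal (sk i)).
  move=> i i' /(congr1 val) /= E; apply: val_inj => /=; move: E; rewrite /s.
  by split_ifs; lia.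
exists (odd_perm (perm s_inj)) => T V a e TV.
split; rewrite -rdet_perm; apply: rdet_ext => i; rewrite /= permE /repl.
all: rewrite -!val_eqE /= h0 hp.
all: case: eqP => [si0|/eqP n0].
- congr V; move: si0; rewrite /block_index /s; split_ifs; lia.
- case: eqP => [sip|/eqP np].
    congr V; move: sip; rewrite /block_index /s; split_ifs; lia.
  rewrite TV -?val_eqE /= ?h0 ?hp //; congr V; move: n0 np.
  by rewrite /block_index /s; split_ifs; lia.
- congr V; move: si0; rewrite /block_index /s; split_ifs; lia.
- case: eqP => [sip|/eqP np].
    congr V; move: sip; rewrite /block_index /s; split_ifs; lia.
  rewrite TV -?val_eqE /= ?h0 ?hp //; congr V; move: n0 np.
  by rewrite /block_index /s; split_ifs; lia.
Qed.

Lemma rdet2_move f (i j : 'I_k) (x y z : 'rV[R]_k) t : i != j ->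
  rdet2 f i j x (y + t *: z) = rdet2 f i j x y + t * rdet2 f i j x z.
Proof.
by move=> ij; rewrite !(rdet2C f x _ ij) {1}/rdet2 (rdet_move _ _ y z t) opprD mulrN.
Qed.

Lemma rdet2_movel f (i j : 'I_k) (x y z : 'rV[R]_k) t :
  rdet2 f i j (x + t *: z) y = rdet2 f i j x y + t * rdet2 f i j z y.
Proof. exact: rdet_move. Qed.

Definition neighbours V p a e : R :=
  block_minor V p.+1 a.+1 e * (block_minor V p a e * block_minor V p a.+1 e).

(** With [m = B C], the relation reads [Q A = P r + m] before the move and
    [Q A' = P' r + m] after it, and [Q] has the sign of [P'].  If [P'] had the
    sign opposite to [m A'], hence to [m A], then [m P r] and [m P' r] would
    both be negative, contrary to [P P' < 0]. *)
Lemma event_sign (P P' Q A A' B C r t : R) :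
    P' = P + t * Q -> A' = A + t * r -> 0 < t ->
    P * r - Q * A + B * C = 0 -> P * P' < 0 ->
    0 < (C * (B * A)) * (C * (B * A')) ->
  0 < P' * (C * (B * A')).
Proof.
move=> EP EA t0 plu PP; have plu' : P' * r - Q * A' + B * C = 0.
  by rewrite EP EA; lra.
have QP : 0 < Q * P'.
  have : 0 < (t * Q) * P'.
    have -> : t * Q = P' - P by rewrite EP; ring.
    rewrite mulrBl subr_gt0 (lt_le_trans PP) // -expr2; exact: sqr_ge0.
  by rewrite -mulrA pmulr_rgt0.
move: plu plu'; rewrite !(mulrCA C B) !(mulrA B C).
move: (B * C) => m {EP EA} plu plu'.
have -> : m * A * (m * A') = m ^+ 2 * (A * A') by ring.
have [->|m0] := eqVneq m 0; first by rewrite expr0n /= mul0r ltxx.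
have m2 : 0 < m ^+ 2 by rewrite exprn_even_gt0.
rewrite pmulr_rgt0 // => AA; rewrite ltNge; apply/negP => le0.
have P'2 : 0 < P' ^+ 2.
  by rewrite exprn_even_gt0 //=; apply: contraTneq PP => ->; rewrite mulr0 ltxx.
have A'2 : 0 < A' ^+ 2.
  by rewrite exprn_even_gt0 //=; apply: contraTneq AA => ->; rewrite mulr0 ltxx.
have QA' : Q * A' * m <= 0.
  rewrite -(pmulr_rle0 _ P'2).
  have -> : P' ^+ 2 * (Q * A' * m) = (Q * P') * (P' * (m * A')) by ring.
  by rewrite pmulr_rle0.
have QA : Q * A * m <= 0.
  rewrite -(pmulr_rle0 _ A'2).
  have -> : A' ^+ 2 * (Q * A * m) = (A * A') * (Q * A' * m) by ring.
  by rewrite pmulr_rle0.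
have Pr : P * r * m < 0.
  have -> : P * r * m = Q * A * m - m ^+ 2.
    have -> : P * r = Q * A - m by lra.
    ring.
  by lra.
have P'r : P' * r * m < 0.
  have -> : P' * r * m = Q * A' * m - m ^+ 2.
    have -> : P' * r = Q * A' - m by lra.
    ring.
  by lra.
have : 0 < (P * r * m) * (P' * r * m) by rewrite nmulr_rgt0.
have -> : (P * r * m) * (P' * r * m) = (P * P') * (r * m) ^+ 2 by ring.
by rewrite ltNge mulr_le0_ge0 ?sqr_ge0 // ltW.
Qed.

(** At a sign change, the minor moves to the sign of [neighbours], unless
    [neighbours] changes sign at the same move.  For [p = 0] the last two factors
    of [neighbours] coincide and the minor moves in the direction of the
    first one. *)
Lemma sign_change_event p a e : (p < k)%N -> (a < e)%N ->
  forall V W j t, vector_move V W j t -> 0 < t -> (j.+1 < e + k)%N ->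
    block_minor V p.+1 a e * block_minor W p.+1 a e < 0 ->
    0 < neighbours V p a e * neighbours W p a e ->
  0 < block_minor W p.+1 a e * neighbours W p a e.
Proof.
move=> pk ae.
have moved V W j t : vector_move V W j t -> (j.+1 < e + k)%N ->
    block_minor V p.+1 a e * block_minor W p.+1 a e < 0 -> j = (a + p)%N.
  move=> mv jn; apply: contraTeq => jap.
  have -> : block_minor W p.+1 a e = block_minor V p.+1 a e.
    apply: (block_minor_unchanged mv jn (ltnW ae) pk); constructor 3.
    by move/eqP: jap; lia.
  by rewrite -leNgt -expr2 sqr_ge0.
have [p0|p0] := posnP p.
  subst p => V W j t mv t0 jn fVW gVW; have E := moved _ _ _ _ mv jn fVW.
  rewrite E addn0 in mv jn.
  have k0 : (0 < k)%N by [].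
  have [Wa Wi] := mv.
  have fW : block_minor W 1 a e = block_minor V 1 a e + t * block_minor V 1 a.+1 e.
    pose f (i : 'I_k) := V (block_index 1 a e i).
    have E1 (U : nat -> 'rV[R]_k) b : (forall i, (e < i)%N -> U i = V i) ->
        block_minor U 1 b e = rdet (repl f (Ordinal k0) (U b)).
      move=> UV; apply: rdet_ext => i; rewrite /repl -val_eqE /= /f /block_index.
      case: eqP => [->|/eqP i0]; first by rewrite addn0.
      by rewrite ltnS leqn0 (negPf i0) UV //; move: i0; lia.
    rewrite !E1 ?Wa ?rdet_move // => i ei; apply: Wi; lia.
  have u3 : block_minor W 1 a.+1 e = block_minor V 1 a.+1 e.
    apply: (block_minor_unchanged mv) => //; constructor 3; lia.
  have E0 U : block_minor U 0 a e = block_minor U 0 a.+1 e by [].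
  have f1 : 0 < block_minor W 0 a.+1 e ^+ 2.
    rewrite exprn_even_gt0 //=; apply: contraTneq gVW => f10.
    by rewrite /neighbours f10 !mulr0 ltxx.
  rewrite /neighbours E0 -expr2 mulrA pmulr_lgt0 // u3 -(pmulr_rgt0 _ t0).
  have -> : t * (block_minor W 1 a e * block_minor V 1 a.+1 e)
      = block_minor W 1 a e ^+ 2 - block_minor V 1 a e * block_minor W 1 a e.
    by rewrite fW; ring.
  by rewrite subr_gt0 (lt_le_trans fVW) ?sqr_ge0.
have i0k : (0 < k)%N by lia.
pose i0 := Ordinal i0k; pose ip := Ordinal pk.
have i0p : i0 != ip by rewrite -val_eqE /= neq_ltn p0.
have [b shift] := block_minor_shift (erefl : i0 = 0%N :> nat) (erefl : ip = p :> nat) p0.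
move=> V W j t mv t0 jn fVW gVW; have E := moved _ _ _ _ mv jn fVW.
rewrite E in mv jn.
pose T (i : 'I_k) := V (block_index p a e i).
have [Wj Wi] := mv.
have TV : agrees_off T V p a e i0 ip by [].
have TW : agrees_off T W p a e i0 ip.
  move=> i _ ; rewrite -val_eqE /= => np; rewrite /T Wi // /block_index.
  by move: np; split_ifs; lia.
have u2 : block_minor W p a e = block_minor V p a e.
  apply: (block_minor_unchanged mv) => //; [lia|lia|constructor 3; lia].
have u3 : block_minor W p.+1 a.+1 e = block_minor V p.+1 a.+1 e.
  apply: (block_minor_unchanged mv) => //; constructor 3; lia.
have [fV f2] := block_minor_first (erefl : i0 = 0%N :> nat) (erefl : ip = p :> nat) p0 TV.
have [fW _] := block_minor_first (erefl : i0 = 0%N :> nat) (erefl : ip = p :> nat) p0 TW.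
have [f1V f3] := shift _ _ _ _ TV.
have [f1W _] := shift _ _ _ _ TW.
have Wa : W a = V a by apply: Wi; lia.
have We : W (e + p)%N = V (e + p)%N by apply: Wi; lia.
rewrite Wa Wj rdet2_move // -fV in fW.
rewrite We Wj rdet2_movel mulrDr -f1V mulrCA in f1W.
move: gVW; rewrite /neighbours u2 u3 => gVW.
have plu := plucker T (V a) (V (a + p)%N) (V (a + p).+1) (V (e + p)%N) i0p.
apply: (event_sign fW f1W t0 _ fVW gVW).
rewrite f2 f3 f1V -[RHS](mulr0 ((-1) ^+ b)) -plu -fV; ring.
Qed.

Lemma block_minor_sign_changes l (V : nat -> nat -> 'rV[R]_k) e :
    (forall s, (s < l)%N -> exists j t,
       [/\ vector_move (V s) (V s.+1) j t, 0 < t & (j.+1 < e + k)%N]) ->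
    (forall s p a, (s <= l)%N -> (p <= k)%N -> (a <= e)%N ->
       block_minor (V s) p a e != 0) ->
  forall p a, (p <= k)%N -> (a <= e)%N ->
  (sign_changes (fun s => block_minor (V s) p a e) l <= half_delannoy p (e - a))%N.
Proof.
move=> moveV nz.
have const p a : (p <= k)%N -> (a <= e)%N -> p = 0%N \/ a = e ->
    sign_changes (fun s => block_minor (V s) p a e) l = 0%N.
  move=> pk ae hyp; apply: big1 => s _; have [j [t [mv _ jn]]] := moveV s (ltn_ord s).
  rewrite (block_minor_unchanged mv jn ae pk) ?ltNge -?expr2 ?sqr_ge0 //.
  by case: hyp; [constructor 1|constructor 2].
elim=> [|p IHp] a pk ae; first by rewrite const //; left.
have H d c : (c + d)%N = e ->
    (sign_changes (fun s => block_minor (V s) p.+1 c e) l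
       <= half_delannoy p.+1 d)%N.
  elim: d c => [|d IHd] c cde.
    by rewrite const //; [lia|right; lia].
  have ce : (c < e)%N by lia.
  have le1 := IHd c.+1 ltac:(lia).
  have le2 := IHp c (ltnW pk) (ltnW ce).
  have le3 := IHp c.+1 (ltnW pk) ce.
  rewrite half_delannoyS; have <- : (e - c)%N = d.+1 by lia.
  have {2}<- : (e - c.+1)%N = d by lia.
  pose g s := neighbours (V s) p c e.
  have : (sign_changes (fun s => block_minor (V s) p.+1 c e) l
      <= (sign_changes g l).+1)%N.
    apply: sign_changes_comparison => [s sl|s sl|s sl].
    - by rewrite nz // ltnW.
    - by rewrite !mulf_neq0 ?nz // ltnW.
    - have [j [t [mv t0 jn]]] := moveV s sl.
      exact: (sign_change_event pk ce mv t0 jn).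
  have := sign_changesM (fun s => block_minor (V s) p.+1 c.+1 e)
    (fun s => block_minor (V s) p c e * block_minor (V s) p c.+1 e) l.
  have := sign_changesM (fun s => block_minor (V s) p c e)
    (fun s => block_minor (V s) p c.+1 e) l.
  rewrite -/g; lia.
by apply: H; rewrite subnKC.
Qed.

End BlockMinors.

(** * Convex sequences of matrices *)

(** A different order of the columns of [J] costs a sign that does not depend on
    the matrix, hence is harmless both for vanishing and for sign changes. *)
Lemma minorJ_sign (k n : nat) (h : 'I_k -> 'I_n) (J : {set 'I_n}) (HJ : #|J| = k) :
    injective h -> (forall i, h i \in J) ->
  exists b : bool, forall (R : realType) (M : 'M[R]_(k, n)),
    minorJ HJ M = (-1) ^+ b * rdet (fun i => (col (h i) M)^T).
Proof.
move=> h_inj hJ.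
pose g i := cast_ord HJ (enum_rank_in (hJ i) (h i)).
have gE i : subset_elt HJ (g i) = h i.
  by rewrite /subset_elt cast_ordK enum_rankK_in.
have g_inj : injective g.
  by move=> i i' E; apply: h_inj; rewrite -!gE E.
exists (odd_perm (perm g_inj)) => R M.
rewrite /minorJ -det_tr.
rewrite (rdet_ext (f' := (fun i => (col (subset_elt HJ i) M)^T) \o perm g_inj)).
  2: by move=> i; rewrite /= permE gE.
rewrite rdet_perm mulrA -signr_addb addbb mul1r; congr (\det _).
by apply/matrixP => i j; rewrite !mxE.
Qed.

(** Columns are indexed by [nat], with value [0] beyond the last one, so that
    index arithmetic needs no bounds. *)
Definition column (R : realType) (k n : nat) (M : 'M[R]_(k, n)) (j : nat) : 'rV[R]_k :=
  oapp (fun j' : 'I_n => (col j' M)^T) 0 (insub j).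

Lemma column_ord (R : realType) (k n : nat) (M : 'M[R]_(k, n)) (j : 'I_n) :
  column M j = (col j M)^T.
Proof. by rewrite /column valK. Qed.

Lemma block_index_lt (k p a e : nat) (i : 'I_k) :
  (a <= e)%N -> (block_index p a e i < e + k)%N.
Proof. by rewrite /block_index; have := ltn_ord i; case: ifP; lia. Qed.

Lemma block_index_inj (k p a e : nat) : (a <= e)%N ->
  injective (fun i : 'I_k => block_index p a e i).
Proof.
move=> ae i i'; rewrite /block_index => E; apply: val_inj.
by move: E => /=; case: ifP; case: ifP; lia.
Qed.

Lemma block_minor_minorJ (k n p a e : nat) (J : {set 'I_n}) (HJ : #|J| = k) :
    (e + k)%N = n -> (a <= e)%N ->
    (forall (i : 'I_k) (j : 'I_n), j = block_index p a e i :> nat -> j \in J) ->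
  exists b : bool, forall (R : realType) (M : 'M[R]_(k, n)),
    minorJ HJ M = (-1) ^+ b * block_minor (column M) p a e.
Proof.
move=> en ae HJi.
have lt_n (i : 'I_k) : (block_index p a e i < n)%N by rewrite -en block_index_lt.
pose h i := Ordinal (lt_n i).
have h_inj : injective h by move=> i i' /(congr1 val) /(block_index_inj ae).
have [b E] := minorJ_sign HJ h_inj (fun i => HJi i (h i) (erefl _)).
exists b => R M; rewrite E; congr (_ * _); apply: rdet_ext => i.
by rewrite -column_ord.
Qed.

Lemma block_minor_neq0 (R : realType) (k n p a e : nat) (M : 'M[R]_(k, n)) :
    (e + k)%N = n -> (a <= e)%N -> in_Cstar M ->
  block_minor (column M) p a e != 0.
Proof.
move=> en ae starM.
have lt_n (i : 'I_k) : (block_index p a e i < n)%N by rewrite -en block_index_lt.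
pose h i := Ordinal (lt_n i).
have h_inj : injective h by move=> i i' /(congr1 val) /(block_index_inj ae).
have HJ : #|[set h i | i : 'I_k]| = k by rewrite card_imset // card_ord.
have [|b E] := block_minor_minorJ (p := p) HJ en ae.
  by move=> i j ji; apply/imsetP; exists i => //; apply: val_inj.
by have := starM _ HJ; rewrite E; apply: contraNneq => ->; rewrite mulr0.
Qed.

Lemma nsc_le_half_delannoy (R : realType) (k n l : nat) (le_kn : (k <= n)%N)
    (M : 'I_l.+1 -> 'M[R]_(k, n)) :
    convex_seq M -> (forall s, in_Cstar (M s)) ->
  (nsc le_kn M <= half_delannoy k (n - k))%N.
Proof.
move=> convM starM; have en : (n - k + k)%N = n by rewrite subnK.
pose V s := column (M (inord s)).
have curE (s : 'I_l) : seq_cur M s = M (inord s).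
  by congr M; apply: val_inj; rewrite /= inordK // ltnW // ltnS.
have nextE (s : 'I_l) : seq_next M s = M (inord s.+1).
  by congr M; apply: val_inj; rewrite /= inordK // ltnS.
have [|b mE] :=
    block_minor_minorJ (p := k) (card_first_cols le_kn) en (leq0n _).
  by move=> i j; rewrite inE /block_index ltn_ord => ->; exact: ltn_ord.
have -> : nsc le_kn M = sign_changes (fun s => block_minor (V s) k 0 (n - k)) l.
  rewrite /nsc /sign_changes -sum1dep_card big_mkcond /=; apply: eq_bigr => s _.
  rewrite /m_bullet !mE curE nextE mulrACA -signr_addb addbb mul1r.
  by case: ifP.
rewrite -[X in half_delannoy k X]subn0.
apply: block_minor_sign_changes => // [s sl | s p a sl pk ae]; last first.
  exact: block_minor_neq0.
have [j [j1 [t [j1E t0 cj cj']]]] := convM (Ordinal sl).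
rewrite curE nextE /= in cj cj'.
exists j, t; split=> //; last by rewrite en -j1E.
split=> [|i ij].
  by rewrite /V -j1E !column_ord cj linearD linearZ.
have [ni|ni] := ltnP i n; last by rewrite /V /column insubN // -leqNgt.
rewrite /V -[i]/(nat_of_ord (Ordinal ni)) !column_ord cj' //.
by apply/eqP => /(congr1 val).
Qed.

Theorem theorem1 (R : realType) (k n : nat) (lt2k : (2 < k)%N)
    (ltkn : (k < n)%N) (l : nat) (M : 'I_l.+1 -> 'M[R]_(k, n))
    (convM : convex_seq M) (starM : forall s : 'I_l.+1, in_Cstar (M s)) :
  (nsc (ltnW ltkn) M)%:R
    < (n - k + 1)%:R ^+ (2 * k - 3) / 2 ^+ (k - 3) :> R.
Proof.
have le := nsc_le_half_delannoy (ltnW ltkn) convM starM.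
have d0 : (0 < n - k)%N by rewrite subn_gt0.
have lt := half_delannoy_bound (k - 3) d0.
rewrite ltr_pdivlMr ?exprn_gt0 // -!natrX -natrM ltr_nat addn1.
have kE : (k - 3).+3 = k by lia.
have eE : (2 * (k - 3)).+3 = (2 * k - 3)%N by lia.
rewrite kE eE in lt; rewrite mulnC; apply: leq_ltn_trans lt.
by rewrite leq_mul2l le orbT.
Qed.
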